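(* Let $(R,\mathfrak m)$ be a noetherian local integral domain with fraction field $Q$, $R$-completion $\widetilde R$ and $\mathfrak m$-adic completion $\widehat R$. Assume $R\neq\widetilde R$ (i.e. $R$ is a proper subring of $\widetilde R$ via the canonical map). Then $$\operatorname{pd}_R(Q)=\operatorname{pd}_R(\widetilde R)\le \operatorname{pd}_R(\widehat R).$$
   Context: $\operatorname{pd}_R$ denotes projective dimension. For an integral domain $R$, $\widetilde R$ denotes the completion of $R$ in the $R$-topology, $\widetilde R=\varprojlim_{0\ne r\in R}R/rR$, with canonical ring map $R\to\widetilde R$. *)

(* Defs.v *)
From HB Require Import structures.
From mathcomp Require Import all_boot all_order all_algebra.
From mathcomp Require Import boolp classical_sets constructive_ereal.

Set Implicit Arguments.
Unset Strict Implicit.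
Unset Printing Implicit Defensive.

Import Order.TTheory GRing.Theory Num.Theory.
Local Open Scope classical_set_scope.
Local Open Scope ring_scope.
Local Open Scope quotient_scope.

(* MathComp's [idealr] only covers proper decidable ideals.  The unit ideal is
   needed here, both as I^0 and as rR for r a unit. *)
Definition is_ideal (R : comPzRingType) (I : set R) : Prop :=
  [/\ I 0, forall x y, I x -> I y -> I (x + y) & forall a x, I x -> I (a * x)].

Record ideal (R : comPzRingType) := Ideal {
  ideal_set :> set R;
  idealP : is_ideal ideal_set
}.

Section Ideals.
Variable R : comPzRingType.
Implicit Types (I J : ideal R).

Definition gen_set (s : seq R) : set R :=
  [set x | exists c : 'I_(size s) -> R, x = \sum_(i < size s) c i * s`_i].

Definition noetherian : Prop :=
  forall I, exists s : seq R, ideal_set I = gen_set s.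

Definition maximal_ideal I : Prop :=
  ideal_set I <> setT /\
  forall J, I `<=` J -> ideal_set J = ideal_set I \/ ideal_set J = setT.

Definition local_ring I : Prop :=
  maximal_ideal I /\
  forall J, maximal_ideal J -> ideal_set J = ideal_set I.

Lemma is_ideal_unit : is_ideal ([set: R]).
Proof. by []. Qed.
Definition ideal_unit : ideal R := Ideal is_ideal_unit.

Definition principal_set (r : R) : set R := [set x | exists a, x = a * r].
Lemma is_ideal_principal r : is_ideal (principal_set r).
Proof.
split; first by exists 0; rewrite mul0r.
- by move=> _ _ [a ->] [b ->]; exists (a + b); rewrite mulrDl.
- by move=> b _ [a ->]; exists (b * a); rewrite mulrA.
Qed.
Definition principal r : ideal R := Ideal (is_ideal_principal r).

Definition mul_set I J : set R :=
  [set x | exists s : seq (R * R),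
     (forall p, p \in s -> ideal_set I p.1 /\ ideal_set J p.2) /\ x = \sum_(p <- s) p.1 * p.2].
Lemma is_ideal_mul I J : is_ideal (mul_set I J).
Proof.
split; first by exists [::]; rewrite big_nil.
- move=> _ _ [s [sIJ ->]] [t [tIJ ->]]; exists (s ++ t); rewrite big_cat.
  by split=> // p; rewrite mem_cat => /orP[/sIJ|/tIJ].
- move=> a _ [s [sIJ ->]]; exists [seq (a * p.1, p.2) | p <- s]; split.
    move=> _ /mapP[p /sIJ[Ip Jp] ->]; split=> //=.
    by case: (idealP I) => _ _; apply.
  by rewrite big_map mulr_sumr; apply: eq_bigr => p _; rewrite /= mulrA.
Qed.
Definition ideal_mul I J : ideal R := Ideal (is_ideal_mul I J).

Definition ideal_exp I (n : nat) : ideal R := iter n (ideal_mul I) ideal_unit.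

End Ideals.

Section ResidueRing.
Variables (R : comPzRingType) (I : ideal R).

Definition ideal_pred : R -> bool := fun x => `[< ideal_set I x >].

Lemma ideal_pred_zmod_closed : zmod_closed ideal_pred.
Proof.
have [I0 ID IM] := idealP I; split=> [|x y /asboolP Ix /asboolP Iy].
  exact/asboolP.
by apply/asboolP; apply: ID => //; rewrite -mulN1r; apply: IM.
Qed.
HB.instance Definition _ :=
  GRing.isZmodClosed.Build R ideal_pred ideal_pred_zmod_closed.

(* R/I.  The zero ring is allowed, which MathComp's [{ideal_quot _}] excludes. *)
Definition residue : Type :=
  Quotient.quot (GRing.ZmodClosed.clone R ideal_pred _).
HB.instance Definition _ := GRing.Zmodule.on residue.
HB.instance Definition _ := EqQuotient.on residue.

Definition residue_map : R -> residue := \pi_residue.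

Lemma residue_eqP x y : residue_map x = residue_map y <-> ideal_set I (x - y).
Proof.
have E : (x == y %[mod residue]) = (x - y \in ideal_pred).
  by rewrite -Quotient.idealrBE.
split=> [/eqP|Ixy]; first by rewrite [X in is_true X]E => /asboolP.
by apply/eqP; rewrite [X in is_true X]E; apply/asboolP.
Qed.

Lemma residue_mapK (x : residue) : residue_map (repr x) = x.
Proof. exact: reprK. Qed.

Lemma residue_mapB : zmod_morphism residue_map.
Proof.
exact: (@pi_is_zmod_morphism _ _ _
  (Quotient.quot (GRing.ZmodClosed.clone R ideal_pred _))).
Qed.
HB.instance Definition _ :=
  GRing.isZmodMorphism.Build R residue residue_map residue_mapB.

Definition residue_one : residue := residue_map 1.
Definition residue_mul (x y : residue) : residue :=
  residue_map (repr x * repr y).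

Lemma residue_mulE x y :
  residue_mul (residue_map x) (residue_map y) = residue_map (x * y).
Proof.
have [I0 ID IM] := idealP I; apply/residue_eqP.
set x' := repr _; set y' := repr _.
have Ix : ideal_set I (x' - x) by apply/residue_eqP; rewrite residue_mapK.
have Iy : ideal_set I (y' - y) by apply/residue_eqP; rewrite residue_mapK.
have -> : x' * y' - x * y = x' * (y' - y) + y * (x' - x).
  by rewrite !mulrBr [y * x']mulrC [y * x]mulrC addrA subrK.
by apply: ID; apply: IM.
Qed.

Lemma residue_mulA : associative residue_mul.
Proof.
move=> x y z; rewrite -(residue_mapK x) -(residue_mapK y) -(residue_mapK z).
by rewrite !residue_mulE mulrA.
Qed.

Lemma residue_mulC : commutative residue_mul.
Proof. by move=> x y; rewrite /residue_mul mulrC. Qed.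

Lemma residue_mul1 : left_id residue_one residue_mul.
Proof.
by move=> x; rewrite -(residue_mapK x) residue_mulE mul1r.
Qed.

Lemma residue_mulD : left_distributive residue_mul +%R.
Proof.
move=> x y z; rewrite -(residue_mapK x) -(residue_mapK y) -(residue_mapK z).
by rewrite -raddfD !residue_mulE mulrDl raddfD.
Qed.

HB.instance Definition _ := GRing.Zmodule_isComPzRing.Build residue
  residue_mulA residue_mulC residue_mul1 residue_mulD.

Lemma residue_map_monoid : monoid_morphism residue_map.
Proof. by split=> // x y; rewrite -residue_mulE. Qed.
HB.instance Definition _ :=
  GRing.isMonoidMorphism.Build R residue residue_map residue_map_monoid.

End ResidueRing.

Arguments residue {R} I.
Arguments residue_map {R} I x.

Section ResidueProduct.
Variables (R : comPzRingType) (T : Type) (J : T -> ideal R).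

Definition residue_prod : Type := forall i : T, residue (J i).
Implicit Types x y z : residue_prod.

HB.instance Definition _ := gen_eqMixin residue_prod.
HB.instance Definition _ := gen_choiceMixin residue_prod.

Let add x y : residue_prod := fun i => x i + y i.
Let mul x y : residue_prod := fun i => x i * y i.
Let opp x : residue_prod := fun i => - x i.
Let zero : residue_prod := fun i => 0.
Let one : residue_prod := fun i => 1.

Fact residue_prod_addA : associative add.
Proof. by move=> x y z; apply: functional_extensionality_dep => i; exact: addrA. Qed.
Fact residue_prod_addC : commutative add.
Proof. by move=> x y; apply: functional_extensionality_dep => i; exact: addrC. Qed.
Fact residue_prod_add0 : left_id zero add.
Proof. by move=> x; apply: functional_extensionality_dep => i; exact: add0r. Qed.
Fact residue_prod_addN : left_inverse zero opp add.
Proof. by move=> x; apply: functional_extensionality_dep => i; exact: addNr. Qed.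
HB.instance Definition _ := GRing.isZmodule.Build residue_prod
  residue_prod_addA residue_prod_addC residue_prod_add0 residue_prod_addN.

Fact residue_prod_mulA : associative mul.
Proof. by move=> x y z; apply: functional_extensionality_dep => i; exact: mulrA. Qed.
Fact residue_prod_mulC : commutative mul.
Proof. by move=> x y; apply: functional_extensionality_dep => i; exact: mulrC. Qed.
Fact residue_prod_mul1 : left_id one mul.
Proof. by move=> x; apply: functional_extensionality_dep => i; exact: mul1r. Qed.
Fact residue_prod_mulD : left_distributive mul +%R.
Proof. by move=> x y z; apply: functional_extensionality_dep => i; exact: mulrDl. Qed.
HB.instance Definition _ := GRing.Zmodule_isComPzRing.Build residue_prod
  residue_prod_mulA residue_prod_mulC residue_prod_mul1 residue_prod_mulD.

End ResidueProduct.

Section InverseLimit.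
Variables (R : comPzRingType) (T : Type) (J : T -> ideal R).

(* For J i contained in J j, the map [x |-> residue_map (J j) (repr x)] is the
   transition map R/J i -> R/J j. *)
Definition coherent (x : residue_prod J) : Prop :=
  forall i j, J i `<=` J j -> residue_map (J j) (repr (x i)) = x j.

Lemma coherentP (x : residue_prod J) : coherent x <->
  forall i j, J i `<=` J j -> forall a,
    x i = residue_map (J i) a -> x j = residue_map (J j) a.
Proof.
split=> cx i j Jij; last first.
  by symmetry; apply: (cx i) => //; rewrite residue_mapK.
move=> a xia; rewrite -(cx i j Jij); apply/residue_eqP/Jij/residue_eqP.
by rewrite residue_mapK.
Qed.

Definition coherent_pred : residue_prod J -> bool := fun x => `[< coherent x >].

Lemma coherent_subring_closed : subring_closed coherent_pred.
Proof.
have lift (x : residue_prod J) i : exists a, x i = residue_map (J i) a.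
  by exists (repr (x i)); rewrite residue_mapK.
split=> [|x y /asboolP/coherentP cx /asboolP/coherentP cy
         |x y /asboolP/coherentP cx /asboolP/coherentP cy];
  apply/asboolP/coherentP => i j Jij a.
- by move=> /residue_eqP/Jij/residue_eqP.
- have [b xb] := lift x i; have [c yc] := lift y i; move=> xya.
  change (x j - y j = residue_map (J j) a).
  rewrite (cx i j Jij b xb) (cy i j Jij c yc) -rmorphB.
  by apply/residue_eqP/Jij/residue_eqP; rewrite rmorphB /= -xb -yc -xya.
- have [b xb] := lift x i; have [c yc] := lift y i; move=> xya.
  change (x j * y j = residue_map (J j) a).
  rewrite (cx i j Jij b xb) (cy i j Jij c yc) -rmorphM.
  by apply/residue_eqP/Jij/residue_eqP; rewrite rmorphM /= -xb -yc -xya.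
Qed.
HB.instance Definition _ := GRing.isSubringClosed.Build (residue_prod J)
  coherent_pred coherent_subring_closed.

(* The inverse limit of the rings R/J i, the index i ranging over T ordered by
   reverse inclusion of the ideals J i. *)
Record invlim := InvLim {
  invlim_val :> residue_prod J;
  _ : coherent_pred invlim_val
}.
HB.instance Definition _ := [isSub for invlim_val].
HB.instance Definition _ := [Choice of invlim by <:].
HB.instance Definition _ :=
  GRing.SubChoice_isSubComPzRing.Build (residue_prod J) coherent_pred invlim
    coherent_subring_closed.

Definition invlim_map_val (a : R) : residue_prod J :=
  fun i => residue_map (J i) a.
Lemma invlim_map_subproof a : coherent_pred (invlim_map_val a).
Proof.
by apply/asboolP/coherentP => i j Jij b /residue_eqP/Jij/residue_eqP.
Qed.
Definition invlim_map (a : R) : invlim := InvLim (invlim_map_subproof a).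

Lemma invlim_map_zmod_morphism : zmod_morphism invlim_map.
Proof.
move=> a b; apply/val_inj; apply: functional_extensionality_dep => i.
exact: rmorphB.
Qed.
Lemma invlim_map_monoid_morphism : monoid_morphism invlim_map.
Proof.
split=> [|a b]; apply/val_inj; apply: functional_extensionality_dep => i.
  exact: rmorph1.
exact: rmorphM.
Qed.
HB.instance Definition _ :=
  GRing.isZmodMorphism.Build R invlim invlim_map invlim_map_zmod_morphism.
HB.instance Definition _ :=
  GRing.isMonoidMorphism.Build R invlim invlim_map invlim_map_monoid_morphism.

End InverseLimit.

(* rR is contained in sR iff s divides r, so this is the inverse limit of the
   R/rR over the nonzero r ordered by divisibility. *)
Definition R_completion (R : idomainType) : comPzRingType :=
  invlim (fun r : {r : R | r != 0} => principal (sval r)).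

Definition to_R_completion (R : idomainType) : {rmorphism R -> R_completion R} :=
  invlim_map (fun r : {r : R | r != 0} => principal (sval r)).

Definition adic_completion (R : comPzRingType) (I : ideal R) : comPzRingType :=
  invlim (ideal_exp I).

Definition to_adic_completion (R : comPzRingType) (I : ideal R) :
    {rmorphism R -> adic_completion I} :=
  invlim_map (ideal_exp I).

(* S as an R-module through f. *)
Definition restr_scalars (R S : pzRingType) (f : {rmorphism R -> S}) : Type := S.

Section RestrictionOfScalars.
Variables (R S : pzRingType) (f : {rmorphism R -> S}).
Local Notation M := (restr_scalars f).

HB.instance Definition _ := GRing.Zmodule.on M.

Let scale (a : R) (x : M) : M := f a * (x : S).

Fact restr_scalarsA a b x : scale a (scale b x) = scale (a * b) x.
Proof. by rewrite /scale rmorphM mulrA. Qed.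
Fact restr_scalars1 : left_id 1 scale.
Proof. by move=> x; rewrite /scale rmorph1 mul1r. Qed.
Fact restr_scalarsDr : right_distributive scale +%R.
Proof. by move=> a x y; exact: mulrDr. Qed.
Fact restr_scalarsDl x : {morph scale^~ x : a b / a + b}.
Proof. by move=> a b; rewrite /scale rmorphD; exact: mulrDl. Qed.
HB.instance Definition _ := GRing.Zmodule_isLmodule.Build R M
  restr_scalarsA restr_scalars1 restr_scalarsDr restr_scalarsDl.

End RestrictionOfScalars.

Section ProjectiveDimension.
Variable R : pzRingType.
Implicit Types M N P : lmodType R.

Definition projective P : Prop :=
  forall (M N : lmodType R) (g : {linear M -> N}) (f : {linear P -> N}),
    range g = setT -> exists h : {linear P -> M}, forall x, g (h x) = f x.

Definition ker (M N : lmodType R) (f : {linear M -> N}) : set M :=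
  [set x | f x = 0].

Definition proj_resolution M (P : nat -> lmodType R)
    (d : forall i, {linear P i.+1 -> P i}) (e : {linear P 0 -> M}) : Prop :=
  [/\ forall i, projective (P i),
      range e = setT,
      ker e = range (d 0%N)
    & forall i, ker (d i) = range (d i.+1)].

Definition has_proj_resolution M (n : nat) : Prop :=
  exists (P : nat -> lmodType R) (d : forall i, {linear P i.+1 -> P i})
         (e : {linear P 0 -> M}),
    proj_resolution d e /\ forall i, (n < i)%N -> forall x : P i, x = 0.

(* Least length of a projective resolution, +oo if there is no finite one; the
   zero module gets dimension 0. *)
Definition proj_dim M : \bar int :=
  if pselect (exists n, `[< has_proj_resolution M n >]) is left ex
  then (ex_minn ex)%:Z%:E else +oo%E.

End ProjectiveDimension.

(* Main.v *)
(* Write C = S/R for S the R-completion or the m-adic completion.  The module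
   R~/R is torsion free and divisible, i.e. a nonzero Q-vector space.  A torsion
   free divisible submodule always splits off, so R~/R is a retract of a direct
   sum of copies of Q, while Q embeds in R~/R, hence, by Krull's intersection
   theorem in the rings R/rR, in R^/R, and is a retract of either quotient.
   Along 0 -> R -> S -> S/R -> 0 a bound n on pd (S/R) gives the same bound for
   S, and conversely when n > 0; the case n = 0 of the converse is excluded
   because a projective S would have R as a summand, making Q a submodule of S,
   although S has no nonzero divisible submodule. *)
Require Import Defs.
From HB Require Import structures.
From mathcomp Require Import all_boot all_order all_algebra.
From mathcomp Require Import boolp classical_sets constructive_ereal functions.

Set Implicit Arguments.
Unset Strict Implicit.
Unset Printing Implicit Defensive.

Import Order.TTheory GRing.Theory Num.Theory.
Local Open Scope classical_set_scope.
Local Open Scope ring_scope.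

(** The result is an equality for R~ but only an inequality for R^, because R^/R need not be
    divisible: it contains Q as a retract, yet it need not be covered by copies of Q.

    The assumption on R~ has two uses. Injectivity of R -> R~ makes R a submodule and excludes
    fields; every power of m then has a nonzero element, which is what produces a map R~ -> R^.
    Failure of surjectivity makes R~/R nonzero, so that it has room for Q.

    Neither Ext nor long exact sequences occur: every bound comes from an explicit syzygy, altered
    at most by a projective summand. The obstacle in degree 0 is visible there, since a projective
    cover of S, read as a cover of S/R, acquires R in its kernel. *)

Lemma linear_exists (R : pzRingType) (M N : lmodType R) (f : M -> N) :
  linear f -> exists g : {linear M -> N}, g =1 f.
Proof.
move=> lf.
pose g : {linear M -> N} := HB.pack f (GRing.isLinear.Build R M N *:%R f lf).
by exists g.
Qed.

(** * Submodules and quotient modules *)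

Section Submodules.
Variable R : pzRingType.
Implicit Types M N : lmodType R.

Definition is_submod M (X : set M) : Prop :=
  X 0 /\ forall a x y, X x -> X y -> X (a *: x + y).

Record submod M := Submod { submod_set :> set M; submodP : is_submod submod_set }.

Lemma is_submodZ M (X : set M) a x : is_submod X -> X x -> X (a *: x).
Proof. by move=> [X0 XD] Xx; rewrite -[_ *: _]addr0; apply: XD. Qed.

Lemma is_submodD M (X : set M) x y : is_submod X -> X x -> X y -> X (x + y).
Proof. by move=> [_ XD] Xx Xy; rewrite -[x]scale1r; apply: XD. Qed.

Lemma is_submodB M (X : set M) x y : is_submod X -> X x -> X y -> X (x - y).
Proof. by move=> [_ XD] Xx Xy; rewrite addrC -scaleN1r; apply: XD. Qed.

Lemma is_submod_range M N (f : {linear M -> N}) : is_submod (range f).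
Proof.
split; first by exists 0 => //; rewrite linear0.
by move=> a _ _ [x _ <-] [y _ <-]; exists (a *: x + y) => //; rewrite linearP.
Qed.

Lemma is_submod_ker M N (f : {linear M -> N}) : is_submod (ker f).
Proof.
split; first by rewrite /ker /= linear0.
by move=> a x y; rewrite /ker /= linearP => -> ->; rewrite scaler0 addr0.
Qed.

Definition submod_pred M (X : submod M) : M -> bool := fun x => `[< submod_set X x >].

Lemma submod_pred_closed M (X : submod M) : submod_closed (submod_pred X).
Proof.
have [X0 XD] := submodP X; split; first exact/asboolP.
by move=> a x y /asboolP Xx /asboolP Xy; apply/asboolP; apply: XD.
Qed.
HB.instance Definition _ M (X : submod M) :=
  GRing.isSubmodClosed.Build R M (submod_pred X) (submod_pred_closed X).

Record submod_type M (X : submod M) :=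
  SubmodType { submod_val :> M; _ : submod_pred X submod_val }.
HB.instance Definition _ M (X : submod M) := [isSub for @submod_val M X].
HB.instance Definition _ M (X : submod M) := [Choice of submod_type X by <:].
HB.instance Definition _ M (X : submod M) :=
  [SubChoice_isSubLmodule of submod_type X by <:].

Lemma submod_exists M (X : set M) : is_submod X ->
  exists (K : lmodType R) (i : {linear K -> M}), injective i /\ range i = X.
Proof.
move=> Xsub; pose Y := Submod Xsub.
exists (submod_type Y : lmodType R), (val : {linear submod_type Y -> M}).
split; first exact: val_inj.
apply/seteqP; split=> [_ [x _ <-]|x Xx]; first by apply/asboolP; exact: (valP x).
have Px : submod_pred Y x by exact/asboolP.
by exists (SubmodType Px).
Qed.

End Submodules.

Section Quotients.
Variables (R : pzRingType) (M : lmodType R) (X : submod M).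

Definition quot_mod : Type :=
  Quotient.quot (GRing.ZmodClosed.clone M (submod_pred X) _).
HB.instance Definition _ := GRing.Zmodule.on quot_mod.
HB.instance Definition _ := EqQuotient.on quot_mod.

Local Open Scope quotient_scope.
Definition quot_map : M -> quot_mod := \pi_quot_mod.

Lemma quot_map_eq x y : quot_map x = quot_map y <-> submod_set X (x - y).
Proof.
have E : (x == y %[mod quot_mod]) = (x - y \in submod_pred X).
  by rewrite -Quotient.idealrBE.
split=> [/eqP|Xxy]; first by rewrite [A in is_true A]E => /asboolP.
by apply/eqP; rewrite [A in is_true A]E; apply/asboolP.
Qed.

Lemma quot_mapK x : quot_map (repr x) = x.
Proof. exact: reprK. Qed.

Lemma quot_mapB : zmod_morphism quot_map.
Proof.
exact: (@pi_is_zmod_morphism _ _ _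
  (Quotient.quot (GRing.ZmodClosed.clone M (submod_pred X) _))).
Qed.
HB.instance Definition _ :=
  GRing.isZmodMorphism.Build M quot_mod quot_map quot_mapB.

Definition quot_scale (a : R) (x : quot_mod) : quot_mod :=
  quot_map (a *: repr x).

Lemma quot_scaleE a x : quot_scale a (quot_map x) = quot_map (a *: x).
Proof.
apply/quot_map_eq; rewrite -scalerBr; apply: is_submodZ; first exact: submodP.
by apply/quot_map_eq; rewrite quot_mapK.
Qed.

Fact quot_scaleA a b x : quot_scale a (quot_scale b x) = quot_scale (a * b) x.
Proof. by rewrite -(quot_mapK x) !quot_scaleE scalerA. Qed.
Fact quot_scale1 : left_id 1 quot_scale.
Proof. by move=> x; rewrite -(quot_mapK x) quot_scaleE scale1r. Qed.
Fact quot_scaleDr : right_distributive quot_scale +%R.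
Proof.
move=> a x y; rewrite -(quot_mapK x) -(quot_mapK y) -raddfD !quot_scaleE.
by rewrite scalerDr raddfD.
Qed.
Fact quot_scaleDl x : {morph quot_scale^~ x : a b / a + b}.
Proof.
by move=> a b; rewrite -(quot_mapK x) !quot_scaleE scalerDl raddfD.
Qed.
HB.instance Definition _ := GRing.Zmodule_isLmodule.Build R quot_mod
  quot_scaleA quot_scale1 quot_scaleDr quot_scaleDl.

Lemma quot_map_linear : linear quot_map.
Proof. by move=> a x y; rewrite raddfD /= -quot_scaleE. Qed.

End Quotients.

(** Existential form: exactness of [q] is all that later arguments use, so representatives stay
    hidden. *)
Lemma quotient_exists (R : pzRingType) (M : lmodType R) (X : set M) :
  is_submod X ->
  exists (C : lmodType R) (q : {linear M -> C}), range q = setT /\ ker q = X.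
Proof.
move=> Xsub; pose Y := Submod Xsub.
have [q qE] := linear_exists (@quot_map_linear R M Y).
exists (quot_mod Y : lmodType R), q; split.
  apply/seteqP; split=> // c _; exists (repr c) => //; rewrite qE.
  exact: quot_mapK.
apply/seteqP; rewrite /ker; split=> x /=; rewrite qE.
  by rewrite -(raddf0 (quot_map Y)) => /quot_map_eq; rewrite subr0.
by move=> Xx; rewrite -(raddf0 (quot_map Y)); apply/quot_map_eq; rewrite subr0.
Qed.

(** * Short exact sequences and bounds on projective dimension *)

Section ProjectiveDimensionBounds.
Variable R : pzRingType.
Implicit Types A B C F K L M N P S V : lmodType R.

Lemma surjP T U (f : T -> U) : range f = setT -> forall y, exists x, f x = y.
Proof. by move=> fT y; have : setT y by []; rewrite -fT => -[x _ <-]; exists x. Qed.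

Lemma surjI T U (f : T -> U) : (forall y, exists x, f x = y) -> range f = setT.
Proof.
by move=> fs; apply/seteqP; split=> // y _; have [x <-] := fs y; exists x.
Qed.

Lemma factor_through A K M (i : {linear K -> M}) (f : {linear A -> M}) :
  injective i -> (forall x, range i (f x)) ->
  exists g : {linear A -> K}, forall x, i (g x) = f x.
Proof.
move=> inji fi.
have /choice[g gE] : forall x, exists y, i y = f x.
  by move=> x; have [y _ <-] := fi x; exists y.
have [|h hE] := @linear_exists _ _ _ g.
  by move=> a x y; apply: inji; rewrite linearP !gE linearP.
by exists h => x; rewrite hE.
Qed.

Lemma factor_quotient M N V (q : {linear M -> V}) (h : {linear M -> N}) :
  range q = setT -> (forall x, q x = 0 -> h x = 0) ->
  exists t : {linear V -> N}, forall x, t (q x) = h x.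
Proof.
move=> /surjP/choice[s sE] qh.
have hE x y : q x = q y -> h x = h y.
  move=> qxy; apply/eqP; rewrite -subr_eq0 -raddfB; apply/eqP/qh.
  by rewrite raddfB /= qxy subrr.
have [a x y|t tE] := @linear_exists R V N (h \o s).
  by rewrite /= -linearP; apply: hE; rewrite linearP !sE.
by exists t => x; rewrite tE; apply: hE; rewrite sE.
Qed.

Lemma linear_cancel_exists M N (f : {linear M -> N}) :
  injective f -> range f = setT -> exists g : {linear N -> M}, cancel g f.
Proof.
move=> injf fs; have [x|g gE] := @factor_through N M N f idfun injf.
  by rewrite fs.
by exists g.
Qed.

Definition retract M N : Prop :=
  exists (s : {linear M -> N}) (p : {linear N -> M}), cancel s p.

Definition short_exact K P M (i : {linear K -> P}) (e : {linear P -> M}) :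
  Prop := [/\ injective i, range i = ker e & range e = setT].

Lemma ker_short_exact P M (e : {linear P -> M}) : range e = setT ->
  exists K (i : {linear K -> P}), short_exact i e.
Proof.
by move=> es; have [K [i [inji ri]]] := submod_exists (is_submod_ker e); exists K, i.
Qed.

Lemma exact_comp0 K P M (i : {linear K -> P}) (e : {linear P -> M}) k :
  range i = ker e -> e (i k) = 0.
Proof. by move=> ie; have : range i (i k) by []; rewrite ie. Qed.

Lemma exact_ker K P M (i : {linear K -> P}) (e : {linear P -> M}) x :
  range i = ker e -> e x = 0 -> exists k, i k = x.
Proof. by move=> ie ex; have : ker e x by []; rewrite -ie => -[k _ <-]; exists k. Qed.

Lemma projective_retract P M : retract M P -> projective P -> projective M.
Proof.
move=> [s [p sK]] projP A B g f gs.
have [h hE] := projP A B g (f \o p) gs.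
by exists (h \o s) => x; rewrite /= hE /= sK.
Qed.

Lemma projective_prod P M :
  projective P -> projective M -> projective (P * M : lmodType R)%type.
Proof.
move=> projP projM A B g f gs.
have [i1 i1E] := @linear_exists R P (P * M)%type (fun x => (x, 0))
  ltac:(by move=> a x y; apply/eqP; rewrite -pair_eqE /= scaler0 addr0 !eqxx).
have [i2 i2E] := @linear_exists R M (P * M)%type (fun x => (0, x))
  ltac:(by move=> a x y; apply/eqP; rewrite -pair_eqE /= scaler0 addr0 !eqxx).
have [h1 h1E] := projP A B g (f \o i1) gs.
have [h2 h2E] := projM A B g (f \o i2) gs.
have [|h hE] := @linear_exists R (P * M)%type A (fun x => h1 x.1 + h2 x.2).
  by move=> a x y; rewrite /= !linearP scalerDr addrACA.
exists h => x; rewrite hE linearD h1E h2E /= -linearD; congr (f _).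
by rewrite i1E i2E; apply/eqP; rewrite -pair_eqE /= addr0 add0r !eqxx.
Qed.

Lemma projective_ring : projective (R^o : lmodType R).
Proof.
move=> M N g f /surjP gs; have [m gm] := gs (f 1).
have [|h hE] := @linear_exists R R^o M (fun a => a *: m).
  by move=> a x y; rewrite /= scalerDl scalerA.
by exists h => x; rewrite hE linearZ /= gm -linearZ /= [_ *: _]mulr1.
Qed.

(** Recursion on syzygies replaces indexed families of modules and allows induction on [n]. Its
    agreement with [has_proj_resolution] is proved below in both directions. *)
Fixpoint pd_le n M : Prop :=
  if n is n'.+1 then
    exists P K (i : {linear K -> P}) (e : {linear P -> M}),
      [/\ projective P, short_exact i e & pd_le n' K]
  else projective M.

(** [P] joins the degree 0 term, which leaves the kernel [K] unchanged. *)
Lemma pd_le_prod n M P :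
  projective P -> pd_le n M -> pd_le n (M * P : lmodType R)%type.
Proof.
case: n => [|n] projP /=; first by move=> projM; apply: projective_prod.
move=> [F [K [i [e [projF [inji ie /surjP es] pdK]]]]].
have [|j jE] := @linear_exists R K (F * P)%type (fun x => (i x, 0)).
  by move=> a x y; apply/eqP; rewrite -pair_eqE /= linearP scaler0 addr0 !eqxx.
have [|d dE] := @linear_exists R (F * P)%type (M * P)%type (fun x => (e x.1, x.2)).
  by move=> a x y; apply/eqP; rewrite -pair_eqE /= linearP !eqxx.
exists (F * P)%type, K, j, d; split=> //; first exact: projective_prod.
split=> [x y|//|].
- by rewrite !jE => -[/inji].
- apply/seteqP; rewrite /ker; split=> [_ [x _ <-]|[x y]] /=.
    by rewrite dE jE /= (exact_comp0 _ ie).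
  by rewrite dE /= => -[/(exact_ker ie)[k <-] ->]; exists k; rewrite ?jE.
- by apply: surjI => -[x y]; have [z <-] := es x; exists (z, y); rewrite dE.
Qed.

(* With [P ->> N] projective and [L] the kernel of the composite [P ->> N ->> M],
   the module [L] is a retract of [ker (P ->> N) * P]: no complement of [M] in
   [N] and no comparison of resolutions is needed. *)
Lemma pd_le_retract n M N : retract M N -> pd_le n N -> pd_le n M.
Proof.
elim: n M N => [|n IH] M N /=; first exact: projective_retract.
move=> [s [p sK]] [P [K [i [e [projP [inji ie es] pdK]]]]].
have e's : range (p \o e) = setT.
  apply: surjI => y; have [x ex] := surjP es (s y).
  by exists x; rewrite /= ex sK.
have [L [j [injj je]] _] := ker_short_exact e's.
exists P, L, j, (p \o e); split=> //.
(* [sg] lifts the idempotent [s \o p] along [e]. It carries [L] into [K], while [1 - sg] carries [P]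
   into [L]; hence [l = sg l + (l - sg l)] factors the identity of [L] through [K * P]. *)
have [sg sgE] := projP P N e (s \o (p \o e)) es.
have [a aE] : exists a : {linear L -> K}, forall x, i (a x) = sg (j x).
  have [x|a aE] := @factor_through L K P i (sg \o j) inji; last by exists a.
  rewrite ie /ker /= sgE /=.
  by have := exact_comp0 x je => /= ->; rewrite linear0.
have [|t0 t0E] := @linear_exists R (K * P)%type P (fun x => i x.1 + (x.2 - sg x.2)).
  move=> c x y /=; by rewrite !linearP [_ + y.2 + _]addrACA [LHS]addrACA !scalerDr.
have [x|t tE] := @factor_through _ L P j t0 injj.
  rewrite je /ker /= t0E !linearD !linearN /= sgE /= sK.
  by rewrite (exact_comp0 _ ie) linear0 add0r subrr.
have [|b bE] := @linear_exists R L (K * P)%type (fun x => (a x, j x)).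
  by move=> c x y; apply/eqP; rewrite -pair_eqE /= !linearP !eqxx.
apply: (IH L (K * P)%type); last exact: pd_le_prod.
exists b, t => x; apply: injj.
by rewrite tE t0E bE /= aE addrC subrK.
Qed.

(** The kernel of [P ->> S ->> C] is an extension of [f R] by [K], split by the lift [p0] of [f 1],
    hence isomorphic to [K * R]. This kernel is a first syzygy of [C], whence the index [n.+1]. *)
Lemma pd_le_coker n S C (f : {linear R^o -> S}) (q : {linear S -> C}) :
  short_exact f q -> pd_le n.+1 S -> pd_le n.+1 C.
Proof.
move=> [injf fq qs] [P [K [i [e [projP [inji ie es] pdK]]]]].
have [p0 ep0] := surjP es (f 1).
have [|j jE] := @linear_exists R (K * R^o)%type P (fun x => i x.1 + x.2 *: p0).
  by move=> c x y /=; rewrite linearP scalerDr scalerDl scalerA addrACA.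
have ejE x : e (j x) = f x.2.
  rewrite jE linearD linearZ /= (exact_comp0 _ ie) add0r ep0 -linearZ /=.
  by rewrite [_ *: _]mulr1.
exists P, (K * R^o : lmodType R)%type, j, (q \o e); split=> //.
  split=> [x y jxy||].
  - have xy2 : x.2 = y.2 by apply: injf; rewrite -!ejE jxy.
    move: jxy; rewrite !jE xy2 => /addIr /inji xy1.
    by rewrite (surjective_pairing x) xy1 xy2 -surjective_pairing.
  - apply/seteqP; rewrite /ker; split=> [_ [x _ <-]|x] /=.
      by rewrite ejE (exact_comp0 _ fq).
    move=> /(exact_ker fq)[a fa]; have : e (x - j (0, a)) = 0.
      by rewrite linearB ejE /= fa subrr.
    move=> /(exact_ker ie)[k ik]; exists (k, a) => //.
    by move: ik => /esym/eqP; rewrite subr_eq => /eqP ->; rewrite !jE /= linear0 add0r.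
  - apply: surjI => c; have [y <-] := surjP qs c; have [x <-] := surjP es y.
    by exists x.
by apply: pd_le_prod => //; exact: projective_ring.
Qed.

(** Horseshoe construction in which R resolves itself: the cover [R * P ->> S] has the same kernel
    [K] as [P ->> C]. When [C] is projective the sequence splits. *)
Lemma pd_le_extension n S C (f : {linear R^o -> S}) (q : {linear S -> C}) :
  short_exact f q -> pd_le n C -> pd_le n S.
Proof.
move=> [injf fq qs]; case: n => [projC|n [P [K [i [e [projP [inji ie es] pdK]]]]]].
  have [l lE] := projC S C q idfun qs.
  have [|r0 r0E] := @linear_exists R S S (fun x => x - l (q x)).
    by move=> a x y; rewrite !linearP [LHS]addrACA scalerDr.
  have [x|r rE] := @factor_through S R^o S f r0 injf.
    by rewrite fq /ker /= r0E linearB lE subrr.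
  apply: (@projective_retract (R^o * C)%type); last first.
    by apply: projective_prod => //; exact: projective_ring.
  have [|s sE] := @linear_exists R S (R^o * C)%type (fun x => (r x, q x)).
    by move=> c x y; apply/eqP; rewrite -pair_eqE /= !linearP !eqxx.
  have [|p pE] := @linear_exists R (R^o * C)%type S (fun x => f x.1 + l x.2).
    by move=> c x y; rewrite /= !linearP scalerDr addrACA.
  by exists s, p => x; rewrite pE sE /= rE r0E subrK.
have [l lE] := projP S C q e qs.
have [|d dE] := @linear_exists R (R^o * P)%type S (fun x => f x.1 + l x.2).
  by move=> c x y; rewrite /= !linearP scalerDr addrACA.
have qdE x : q (d x) = e x.2.
  by rewrite dE linearD lE (exact_comp0 _ fq) add0r.
(* [l] sends [i K] into the image of [f]; [r] reads off that value, and the sign in [j] cancels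
   it. *)
have [x|r rE] := @factor_through K R^o S f (l \o i) injf.
  by rewrite fq /ker /= lE (exact_comp0 _ ie).
have [|j jE] := @linear_exists R K (R^o * P)%type (fun x => (- r x, i x)).
  by move=> c x y; apply/eqP; rewrite -pair_eqE /= !linearP !eqxx.
exists (R^o * P : lmodType R)%type, K, j, d; split=> //.
  by apply: projective_prod => //; exact: projective_ring.
split=> [x y|//|].
- by rewrite !jE => -[_ /inji].
- apply/seteqP; rewrite /ker; split=> [_ [x _ <-]|[a x]] /=.
    by rewrite dE jE /= linearN rE addNr.
  move=> dx; have : e x = 0 by rewrite -[x]/(a, x).2 -qdE dx linear0.
  move=> /(exact_ker ie)[k ik]; exists k => //; rewrite jE ik; congr (_, _).
  apply: injf; rewrite linearN rE /= ik; apply/eqP; rewrite eq_sym -addr_eq0.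
  by move: dx; rewrite dE /= => ->.
- apply: surjI => y; have [x ex] := surjP es (q y).
  have : q (y - l x) = 0 by rewrite linearB lE ex subrr.
  by move=> /(exact_ker fq)[a fa]; exists (a, x); rewrite dE /= fa subrK.
Qed.

Lemma has_proj_resolution_pd_le n M : has_proj_resolution M n -> pd_le n M.
Proof.
elim: n M => [|n IH] M [P [d [e [[projP es ed dd] P0]]]].
  (* [P 1] is zero, so [e] is injective as well as surjective. *)
  apply: (projective_retract _ (projP 0%N)).
  have [|g gK] := @linear_cancel_exists _ _ e _ es; last by exists g, e.
  apply: raddf_inj => x ex0; have [y <-] := exact_ker (esym ed) ex0.
  by rewrite (P0 1%N _ y) // linear0.
have [K [i [inji ie _]]] := ker_short_exact es.
exists (P 0%N), K, i, e; split=> //; apply: IH.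
have [x|g gE] := @factor_through _ _ _ i (d 0%N) inji.
  by rewrite ie ed.
exists (fun k => P k.+1), (fun k => d k.+1), g; split; last by move=> k nk; apply: P0.
split=> //.
- apply: surjI => k; have : range i (i k) by [].
  by rewrite ie ed => -[x _ dx]; exists x; apply: inji; rewrite gE.
- rewrite -dd; apply/seteqP; rewrite /ker; split=> x /=; rewrite -gE.
    by move=> ->; rewrite linear0.
  by rewrite -{1}(linear0 i) => /inji.
Qed.

Lemma pd_le_has_proj_resolution n M : pd_le n M -> has_proj_resolution M n.
Proof.
elim: n M => [|n IH] M /=.
  move=> projM.
  pose Z : lmodType R := 'rV[R]_0.
  have Z0 (x : Z) : x = 0 by apply/rowP => -[].
  have projZ : projective Z.
    move=> A B g f _; have [|h hE] := @linear_exists R Z A (fun=> 0).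
      by move=> a x y; rewrite scaler0 addr0.
    by exists h => x; rewrite (Z0 x) !linear0.
  have [|z zE] := @linear_exists R Z M (fun=> 0).
    by move=> a x y; rewrite scaler0 addr0.
  pose P k := if k is k'.+1 then Z else M.
  pose d k : {linear P k.+1 -> P k} :=
    match k with 0 => z | k'.+1 => (idfun : {linear Z -> Z}) end.
  exists P, d, (idfun : {linear M -> M}); split; last by case.
  split=> [[]//|||k].
  - exact: surjI (fun y => ex_intro _ y erefl).
  - apply/seteqP; rewrite /ker; split=> [x /= ->|_ [x _ <-]]; last exact: zE.
    by exists 0 => //; rewrite linear0.
  - apply/seteqP; rewrite /ker; split=> x _ /=; last first.
      by case: k x => [|k] x; rewrite ?zE ?(Z0 x).
    by exists 0 => //; rewrite linear0 (Z0 x).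
move=> [F [K [i [e [projF [inji ie es] /IH[P [d [e' [[projP e's ed dd] P0]]]]]]]]].
pose P' k := if k is k'.+1 then P k' else F.
pose d' k : {linear P' k.+1 -> P' k} :=
  match k with 0 => (i \o e' : {linear P' 1%N -> P' 0%N}) | k'.+1 => d k' end.
exists P', d', e; split; last by case=> // k nk; apply: P0.
split=> [[]//|//||[|k]]; last exact: dd.
- rewrite -ie; apply/seteqP; split=> _ [x _ <-] /=; last by exists (e' x).
  by have [y <-] := surjP e's x; exists y.
- rewrite -ed; apply/seteqP; rewrite /ker; split=> x /=.
    by rewrite -{1}(linear0 i) => /inji.
  by move=> ->; rewrite linear0.
Qed.

Lemma proj_dim_le M N : (forall n, pd_le n N -> pd_le n M) ->
  (proj_dim M <= proj_dim N)%E.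
Proof.
move=> NM; rewrite /proj_dim.
case: pselect => [exM|nexM]; case: pselect => [exN|nexN] //.
- case: ex_minnP => k _ kmin; case: ex_minnP => l /asboolP Nl _.
  rewrite lee_fin lez_nat; apply/kmin/asboolP/pd_le_has_proj_resolution/NM.
  exact: has_proj_resolution_pd_le.
- case: nexM; have [l /asboolP Nl] := exN; exists l; apply/asboolP.
  exact/pd_le_has_proj_resolution/NM/has_proj_resolution_pd_le.
Qed.

End ProjectiveDimensionBounds.

(** * Direct sums of copies of a module *)

Section DirectSums.
Variables (R : pzRingType) (X : eqType).
Implicit Types A K M N P : lmodType R.

Definition finite_support M : set (X -> M) :=
  [set u | exists s : seq X, forall x, x \notin s -> u x = 0].

Lemma is_submod_finite_support M : is_submod (@finite_support M).
Proof.
split=> [|a u v [s us] [t vt]]; first by exists [::].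
exists (s ++ t) => x; rewrite mem_cat negb_or => /andP[/us ux /vt vx].
by change (a *: u x + v x = 0); rewrite ux vx scaler0 addr0.
Qed.

Definition dsum M : lmodType R := submod_type (Submod (@is_submod_finite_support M)).

Definition dsum_coord M (u : dsum M) : X -> M := submod_val u.

Lemma dsum_coordP M a (u v : dsum M) x :
  dsum_coord (a *: u + v) x = a *: dsum_coord u x + dsum_coord v x.
Proof. by []. Qed.

Lemma dsum_coord0 M x : dsum_coord (0 : dsum M) x = 0.
Proof. by []. Qed.

Lemma dsum_ext M (u v : dsum M) : dsum_coord u =1 dsum_coord v -> u = v.
Proof. by move=> uv; apply: val_inj; apply/funext. Qed.

Lemma dsum_support M (u : dsum M) :
  exists s, uniq s /\ forall x, x \notin s -> dsum_coord u x = 0.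
Proof.
have /asboolP[s us] := valP u; exists (undup s); split; first exact: undup_uniq.
by move=> x; rewrite mem_undup => /us.
Qed.

Lemma dsum_of_fun M (f : X -> M) (s : seq X) : (forall x, x \notin s -> f x = 0) ->
  exists u : dsum M, dsum_coord u = f.
Proof.
move=> fs; have Pf : submod_pred (Submod (@is_submod_finite_support M)) f.
  by apply/asboolP; exists s.
by exists (SubmodType Pf).
Qed.

(** Each vector gets an arbitrarily chosen list containing its support, and the lists chosen for
    [u], [v] and [a *: u + v] are unrelated; linearity of a map defined by such sums rests on this
    independence. *)
Lemma big_support M N (h : X -> {linear M -> N}) (u : X -> M) (s t : seq X) :
  uniq s -> uniq t -> (forall x, x \notin s -> u x = 0) ->
  (forall x, x \notin t -> u x = 0) ->
  \sum_(x <- s) h x (u x) = \sum_(x <- t) h x (u x).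
Proof.
move=> us ut su tu.
have restr (r r' : seq X) : (forall x, x \notin r' -> u x = 0) ->
    \sum_(x <- r) h x (u x) = \sum_(x <- r | x \in r') h x (u x).
  move=> r'u; rewrite (bigID (mem r')) /= [X in _ + X]big1 ?addr0 // => x.
  by move=> /r'u ->; rewrite linear0.
rewrite (restr s t) // (restr t s) // -[LHS]big_filter -[RHS]big_filter; apply: perm_big.
apply: uniq_perm; rewrite ?filter_uniq // => x.
by rewrite !mem_filter andbC.
Qed.

Lemma dsum_lift M N (h : X -> {linear M -> N}) :
  exists H : {linear dsum M -> N}, forall u s, uniq s ->
    (forall x, x \notin s -> dsum_coord u x = 0) ->
    H u = \sum_(x <- s) h x (dsum_coord u x).
Proof.
have /choice[c cP] := @dsum_support M.
have cE (u : dsum M) s : uniq s -> (forall x, x \notin s -> dsum_coord u x = 0) ->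
    \sum_(x <- c u) h x (dsum_coord u x) = \sum_(x <- s) h x (dsum_coord u x).
  by move=> us su; have [? ?] := cP u; apply: big_support.
have [|H HE] := @linear_exists R (dsum M) N
    (fun u => \sum_(x <- c u) h x (dsum_coord u x)).
  move=> a u v; set s := undup (c u ++ c v).
  have inl x : x \notin s -> dsum_coord u x = 0.
    rewrite mem_undup mem_cat negb_or => /andP[xu _].
    by have [_ ->] := cP u.
  have inr x : x \notin s -> dsum_coord v x = 0.
    rewrite mem_undup mem_cat negb_or => /andP[_ xv].
    by have [_ ->] := cP v.
  rewrite !(cE _ s) ?undup_uniq //; last first.
    by move=> x xs; rewrite dsum_coordP inl // inr // scaler0 addr0.
  rewrite scaler_sumr -big_split; apply: eq_bigr => x _ /=.
  by rewrite linearP.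
by exists H => u s us su; rewrite HE (cE u s).
Qed.

Lemma dsum_inj_exists M x : exists i : {linear M -> dsum M},
  forall m y, dsum_coord (i m) y = if y == x then m else 0.
Proof.
have /choice[i iE] : forall m : M, exists u : dsum M,
    dsum_coord u = fun y => if y == x then m else 0.
  by move=> m; apply: (@dsum_of_fun _ _ [:: x]) => y; rewrite inE => /negPf ->.
have [|j jE] := @linear_exists _ _ _ i; last by exists j => m y; rewrite jE iE.
move=> a m n; apply: dsum_ext => y; rewrite dsum_coordP !iE.
by case: eqP; rewrite // scaler0 addr0.
Qed.

Lemma dsum_map_exists M N (f : {linear M -> N}) :
  exists F : {linear dsum M -> dsum N},
    forall u x, dsum_coord (F u) x = f (dsum_coord u x).
Proof.
have /choice[F FE] : forall u : dsum M, exists v : dsum N,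
    dsum_coord v = f \o dsum_coord u.
  move=> u; have [s [_ su]] := dsum_support u.
  by apply: (@dsum_of_fun _ _ s) => x /su /= ->; rewrite linear0.
have [|G GE] := @linear_exists _ _ _ F; last by exists G => u x; rewrite GE FE.
move=> a u v; apply: dsum_ext => x; rewrite [RHS]dsum_coordP !FE.
exact: (linearP f).
Qed.

Lemma projective_dsum P : projective P -> projective (dsum P).
Proof.
move=> projP M N g f gs; have /choice[i iE] := @dsum_inj_exists P.
have /choice[h hE] : forall x, exists h : {linear P -> M},
    forall p, g (h p) = f (i x p).
  by move=> x; exact: (projP M N g (f \o i x) gs).
have [H HE] := dsum_lift h; exists H => u.
have [s [us su]] := dsum_support u; rewrite (HE u s) // linear_sum /=.
under eq_bigr do rewrite hE.
rewrite -linear_sum; congr (f _); apply: dsum_ext => y.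
have coord_sum (r : seq X) (F : X -> dsum P) :
    dsum_coord (\sum_(x <- r) F x) y = \sum_(x <- r) dsum_coord (F x) y.
  by elim/big_rec2: _ => // x p v _ <-.
rewrite coord_sum; under eq_bigr do rewrite iE.
have [ys|ys] := boolP (y \in s).
  rewrite (bigD1_seq y) //= eqxx big1 ?addr0 // => x /negPf xy.
  by rewrite eq_sym xy.
rewrite su // big_seq big1 // => x xs; case: eqP => // yx.
by rewrite yx xs in ys.
Qed.

Lemma pd_le_dsum n M : pd_le n M -> pd_le n (dsum M).
Proof.
elim: n M => [|n IH] M /=; first exact: projective_dsum.
move=> [P [K [i [e [projP [inji ie es] pdK]]]]].
have [I IE] := dsum_map_exists i; have [E EE] := dsum_map_exists e.
exists (dsum P), (dsum K), I, E; split; [exact: projective_dsum| |exact: IH].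
have lift K' P' (f : {linear K' -> P'}) (F : {linear dsum K' -> dsum P'}) v :
    (forall u x, dsum_coord (F u) x = f (dsum_coord u x)) ->
    (forall x, exists k, f k = dsum_coord v x) -> exists u, F u = v.
  move=> FE /choice[k kE]; have [s [_ sv]] := dsum_support v.
  (* Preimages are replaced by [0] off the list, which keeps the support finite. *)
  have [x|u uE] := @dsum_of_fun _ (fun x => if x \in s then k x else 0) s.
    by move=> /negPf ->.
  exists u; apply: dsum_ext => x; rewrite FE uE.
  by case: ifPn => [_|xs]; rewrite ?kE // linear0 sv.
split=> [u v uv||].
- by apply: dsum_ext => x; apply: inji; rewrite -!IE uv.
- apply/seteqP; rewrite /ker; split=> [_ [u _ <-]|u] /=.
    by apply: dsum_ext => x; rewrite EE IE (exact_comp0 _ ie).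
  move=> Eu; have [x|k <-] := lift _ _ i I u IE; last by exists k.
  by apply: (exact_ker ie); rewrite -EE Eu.
- apply: surjI => v; apply: (lift _ _ e E v EE) => x; exact: surjP es _.
Qed.

End DirectSums.

(** Zorn's lemma in a form that serves three purposes: a complement to a divisible submodule, a
    maximal ideal, and the ideal in Krull's theorem. *)
Lemma maximal_submod (R : pzRingType) (M : lmodType R) (N0 X : set M) :
  is_submod N0 -> (forall x, N0 x -> ~ X x) ->
  exists N, [/\ is_submod N, N0 `<=` N, forall x, N x -> ~ X x &
    forall y, ~ N y -> exists n r, N n /\ X (n + r *: y)].
Proof.
move=> N0sub N0X.
pose P A := A = set0 \/ [/\ is_submod A, N0 `<=` A & forall x, A x -> ~ X x].
have [F FP Ftot|N [PN Nmax]] := @Zorn_bigcup M P.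
  have [FN|] := pselect (exists A, F A /\ A <> set0); last first.
    move=> F0; left; rewrite -subset0 => x [A FA Ax].
    by apply: F0; exists A; split=> // A0; rewrite A0 in Ax.
  have FS A x : F A -> A x -> [/\ is_submod A, N0 `<=` A & forall x, A x -> ~ X x].
    by move=> /FP[-> []|AH _].
  have [A [FA AN]] := FN; have /set0P[x0 Ax0] : A != set0 by apply/eqP.
  have [[A0 AD] N0A _] := FS _ _ FA Ax0.
  right; split=> [|x N0x|x [B FB Bx]]; last by have [_ _ +] := FS _ _ FB Bx; apply.
    split=> [|a x y [B FB Bx] [C FC Cy]]; first by exists A.
    have [[_ BD] _ _] := FS _ _ FB Bx; have [[_ CD] _ _] := FS _ _ FC Cy.
    have [BC|CB] := Ftot _ _ FB FC; first by exists C => //; apply: CD => //; exact: BC.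
    by exists B => //; apply: BD => //; exact: CB.
  by exists A => //; exact: N0A.
have [Nsub N0N NX] : [/\ is_submod N, N0 `<=` N & forall x, N x -> ~ X x].
  case: PN => // N00; exfalso; apply: (Nmax N0); last by right; split.
  by rewrite N00; split=> [x []|N0e]; apply: (N0e 0); case: N0sub.
exists N; split=> // y Ny; apply: contrapT => nX.
apply: (Nmax [set x | exists n r, N n /\ x = n + r *: y]).
  split=> [x Nx|]; first by exists x, 0; rewrite scale0r addr0.
  move=> /(_ y) NyN; apply/Ny/NyN; exists 0, 1; rewrite scale1r add0r.
  by split=> //; case: Nsub.
right; split=> [|x N0x|_ [n [r [Nn ->]]] Xn]; last by apply: nX; exists n, r.
  split=> [|a _ _ [n [r [Nn ->]]] [n' [r' [Nn' ->]]]].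
    by exists 0, 0; rewrite scale0r addr0; split=> //; case: Nsub.
  exists (a *: n + n'), (a * r + r'); split; first by case: Nsub => _; apply.
  by rewrite scalerDr addrACA scalerA -scalerDl.
by exists x, 0; rewrite scale0r addr0; split=> //; exact: N0N.
Qed.

(** * Torsion free divisible modules and the fraction field *)

Section DivisibleModules.
Variable R : idomainType.
Implicit Types M N V C : lmodType R.

Definition torsion_free M : Prop :=
  forall (r : R) (x : M), r != 0 -> r *: x = 0 -> x = 0.
Definition divisible M : Prop :=
  forall (r : R) (x : M), r != 0 -> exists y, r *: y = x.

Lemma torsion_freeI M (r : R) (x y : M) :
  torsion_free M -> r != 0 -> r *: x = r *: y -> x = y.
Proof.
move=> tfM r0 rxy; apply/eqP; rewrite -subr_eq0; apply/eqP/(tfM r) => //.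
by rewrite scalerBr rxy subrr.
Qed.

(* The complement is a submodule maximal among those meeting [V] trivially. *)
Lemma divisible_split V C (i : {linear V -> C}) : injective i ->
  torsion_free V -> divisible V -> exists p : {linear C -> V}, cancel i p.
Proof.
move=> inji tfV divV.
have [||N [Nsub _ NX Nmax]] := @maximal_submod R C [set 0]
    [set x | exists2 v, v <> 0 & i v = x].
- by split=> // a x y /= -> ->; rewrite scaler0 addr0.
- by move=> _ /= -> [v v0 iv]; apply: v0; apply: inji; rewrite iv linear0.
(* If [n + r *: c = i v], division of [v] by [r] gives [w] with [r *: (c - i w)] in [N]. Were
   [c - i w] outside [N], some [n' + s *: (c - i w)] would be a nonzero [i v'], and multiplication
   by [r] would put the nonzero [i (r *: v')] into [N]. *)
have dec c : exists v, N (c - i v).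
  have [Nc|/Nmax[n [r [Nn [v v0 vE]]]]] := pselect (N c).
    by exists 0; rewrite linear0 subr0.
  have r0 : r != 0.
    apply/eqP => r0; apply: (NX n Nn); exists v => //.
    by rewrite vE r0 scale0r addr0.
  have [w wE] := divV r v r0; exists w; apply: contrapT => /Nmax.
  move=> [n' [s [Nn' [v' v'0 v'E]]]].
  have Nry : N (r *: (c - i w)).
    rewrite scalerBr -linearZ wE vE opprD addrC subrK.
    by rewrite -scaleN1r; apply: is_submodZ.
  apply: (NX (i (r *: v'))); last first.
    by exists (r *: v') => // rv'; apply: v'0; exact: tfV rv'.
  rewrite linearZ /= v'E scalerDr scalerA mulrC -scalerA.
  by apply: is_submodD => //; apply: is_submodZ.
have i0 v : N (i v) -> v = 0.
  by move=> Nv; apply: contrapT => v0; apply: (NX _ Nv); exists v.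
have {dec}/choice[p pE] := dec.
have [a x y|q qE] := @linear_exists R C V p.
  apply/eqP; rewrite -subr_eq0; apply/eqP/i0.
  have -> : i (p (a *: x + y) - (a *: p x + p y)) =
      a *: (x - i (p x)) + (y - i (p y)) - (a *: x + y - i (p (a *: x + y))).
    rewrite scalerBr [in RHS]addrACA -opprD opprB [RHS]addrC addrA subrK.
    by rewrite raddfB /= [i (_ + p y)]linearP.
  by apply: is_submodB => //; case: Nsub => _; apply.
exists q => v; rewrite qE; apply/eqP; rewrite -subr_eq0; apply/eqP/i0.
by rewrite linearB -opprB -scaleN1r; apply: is_submodZ.
Qed.

(** Torsion freeness of [V] makes the kernel of [g] closed under division in [M], hence divisible
    and a summand; the projection away from it descends to a section of [g]. *)
Lemma torsion_free_quotient_retract M V (g : {linear M -> V}) :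
  range g = setT -> torsion_free M -> divisible M -> torsion_free V ->
  retract V M.
Proof.
move=> gs tfM divM tfV.
have [K [j [injj jg _]]] := ker_short_exact gs.
have [||p pK] := @divisible_split K M j injj.
- move=> r x r0 rx; apply: injj; rewrite linear0; apply: (tfM r) => //.
  by rewrite -linearZ rx linear0.
- move=> r x r0; have [y yE] := divM r (j x) r0.
  have : g y = 0 by apply: (tfV r) => //; rewrite -linearZ yE (exact_comp0 _ jg).
  move=> /(exact_ker jg)[k kE]; exists k; apply: injj.
  by rewrite linearZ /= kE.
have [|h hE] := @linear_exists R M M (fun x => x - j (p x)).
  by move=> a x y; rewrite !linearP [LHS]addrACA scalerDr.
have [x|t tE] := @factor_quotient _ _ _ _ g h gs.
  by move=> /(exact_ker jg)[k <-]; rewrite hE pK subrr.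
exists t, g => v; have [x <-] := surjP gs v.
by rewrite tE hE raddfB /= (exact_comp0 _ jg) subr0.
Qed.

Lemma dsum_torsion_free (X : eqType) M : torsion_free M -> torsion_free (dsum X M).
Proof.
move=> tfM r u r0 ru; apply: dsum_ext => x; rewrite dsum_coord0.
by apply: (tfM r) => //; rewrite -[LHS]addr0 -(dsum_coord0 _ x) -dsum_coordP ru add0r.
Qed.

(** Torsion freeness keeps the quotient finitely supported: dividing [0] by [r] can only give
    [0]. *)
Lemma dsum_divisible (X : eqType) M :
  torsion_free M -> divisible M -> divisible (dsum X M).
Proof.
move=> tfM divM r u r0; have [s [_ su]] := dsum_support u.
have /choice[w wE] : forall x, exists y, r *: y = dsum_coord u x.
  by move=> x; exact: divM.
have [x xs|v vE] := @dsum_of_fun R X M w s.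
  by apply: (tfM r) => //; rewrite wE su.
exists v; apply: dsum_ext => x; rewrite -wE -vE.
by rewrite -[LHS]addr0 -(dsum_coord0 _ x) -dsum_coordP addr0.
Qed.

Definition fraction_mod : lmodType R :=
  restr_scalars (@tofrac R : {rmorphism R -> {fraction R}}).

Definition fraction_one : fraction_mod := (1 : {fraction R}).

Lemma fraction_num (q : fraction_mod) :
  exists (a b : R), b != 0 /\ b *: q = (tofrac a : fraction_mod).
Proof.
exists (\n_(repr (q : {fraction R}))), (\d_(repr (q : {fraction R}))).
split; first exact: denom_ratioP.
rewrite [LHS]/(tofrac _ * (q : {fraction R})) -[q in LHS]reprK; unlock tofrac.
rewrite -[LHS]FracField.pi_mul; apply/eqmodP.
rewrite /= FracField.equivfE /FracField.mulf.
rewrite !numden_Ratio ?mul1r ?mulr1 ?denom_ratioP ?oner_neq0 //.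
by rewrite reprK mulrC.
Qed.

Lemma fraction_scale a b :
  a *: (tofrac b : fraction_mod) = (tofrac (a * b) : fraction_mod).
Proof. by rewrite rmorphM. Qed.

Lemma fraction_torsion_free : torsion_free fraction_mod.
Proof.
move=> r q r0 /eqP; rewrite [_ *: _]/(tofrac r * (q : {fraction R})).
by rewrite (@mulf_eq0 {fraction R}) tofrac_eq0 (negPf r0) => /eqP.
Qed.

Lemma fraction_divisible : divisible fraction_mod.
Proof.
move=> r q r0; exists ((tofrac r)^-1 * (q : {fraction R}) : {fraction R}).
rewrite [LHS]/(tofrac r * ((tofrac r)^-1 * (q : {fraction R}))).
by apply: (@mulVKf {fraction R}); rewrite tofrac_eq0.
Qed.

Lemma fraction_lift V (v : V) : torsion_free V -> divisible V ->
  exists f : {linear fraction_mod -> V}, f fraction_one = v.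
Proof.
move=> tfV divV.
(* A fraction [a / b] can only go to the solution [w] of [b *: w = a *: v]. Asking this for every
   presentation of [q] lets linearity be checked on a common denominator. *)
have /choice[f0 f0P] : forall q : fraction_mod, exists w : V,
    forall a b, b != 0 -> b *: q = (tofrac a : fraction_mod) -> b *: w = a *: v.
  move=> q; have [a0 [b0 [b00 qE]]] := fraction_num q.
  have [w wE] := divV b0 (a0 *: v) b00; exists w => a b bn0 qE'.
  apply: (torsion_freeI tfV b00); rewrite [LHS]scalerA mulrC -scalerA wE !scalerA.
  congr (_ *: _); apply/eqP; rewrite -(@tofrac_eq R); apply/eqP.
  have := congr1 ( *:%R b) qE; have := congr1 ( *:%R b0) qE'.
  by rewrite !fraction_scale !scalerA [b * b0]mulrC => -> ->.
have clear_denom (W : lmodType R) (b b' c : R) (x y : W) :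
    (b * b') *: (c *: x + y) = (c * b') *: (b *: x) + b *: (b' *: y).
  rewrite scalerDr !scalerA; congr (_ *: _ + _).
  by rewrite -[LHS]mulrA [b' * c]mulrC [LHS]mulrC.
have [c x y|f fE] := @linear_exists R fraction_mod V f0.
  have [a [b [b0 xE]]] := fraction_num x; have [a' [b' [b'0 yE]]] := fraction_num y.
  have bb' : b * b' != 0 by rewrite mulf_neq0.
  apply: (torsion_freeI tfV bb').
  rewrite (f0P (c *: x + y) (c * b' * a + b * a') (b * b')) //; last first.
    by rewrite clear_denom xE yE !fraction_scale rmorphD.
  rewrite clear_denom (f0P x a b b0 xE) (f0P y a' b' b'0 yE).
  by rewrite !scalerA -scalerDl.
exists f; rewrite fE -[LHS]scale1r -[RHS]scale1r; apply: f0P; first exact: oner_neq0.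
by rewrite scale1r rmorph1.
Qed.

Lemma fraction_mod_injective V (f : {linear fraction_mod -> V}) :
  torsion_free V -> f fraction_one <> 0 -> injective f.
Proof.
move=> tfV f1; apply: raddf_inj => q fq; have [a [b [b0 qE]]] := fraction_num q.
have qE' : b *: q = a *: fraction_one.
  by rewrite qE; exact/esym/(@mulr1 {fraction R}).
have a0 : a = 0.
  apply/eqP/negPn/negP => a0; apply/f1/(tfV a) => //.
  have /esym := congr1 f qE'.
  by rewrite !linearZ /= fq scaler0.
by apply: (fraction_torsion_free b0); rewrite qE a0 rmorph0.
Qed.

(** Indexing the copies of Q by all elements of [V] makes surjectivity immediate and dispenses with
    a basis. *)
Lemma divisible_retract_dsum V : torsion_free V -> divisible V ->
  retract V (dsum V fraction_mod).
Proof.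
move=> tfV divV.
have /choice[h hE] : forall v : V,
    exists f : {linear fraction_mod -> V}, f fraction_one = v.
  by move=> v; exact: fraction_lift.
have [H HE] := dsum_lift h; apply: (@torsion_free_quotient_retract _ _ H) => //.
- apply: surjI => v; have [i iE] := @dsum_inj_exists R V fraction_mod v.
  exists (i fraction_one); rewrite (HE _ [:: v]) ?big_seq1 ?iE ?eqxx // => x.
  by rewrite inE iE => /negPf ->.
- exact/dsum_torsion_free/fraction_torsion_free.
- exact: (dsum_divisible fraction_torsion_free fraction_divisible).
Qed.

Lemma pd_le_divisible n V : torsion_free V -> divisible V ->
  pd_le n fraction_mod -> pd_le n V.
Proof.
move=> tfV divV pdQ; apply: (pd_le_retract (divisible_retract_dsum tfV divV)).
exact: pd_le_dsum.
Qed.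

End DivisibleModules.

(** * Krull's intersection theorem in a noetherian local domain *)

Section Krull.
Variables (R : idomainType) (m : ideal R).
Hypotheses (noethR : noetherian R) (localR : local_ring m).

Lemma is_submod_ideal (I : ideal R) : @is_submod R R^o I.
Proof.
have [I0 ID IM] := idealP I.
by split=> // a x y Ix Iy; apply: ID => //; apply: IM.
Qed.

Lemma is_ideal_submod (I : set R) : @is_submod R R^o I -> is_ideal I.
Proof.
move=> Isub; split; first by case: Isub.
  by move=> x y; exact: (is_submodD Isub).
by move=> a x; exact: (is_submodZ _ Isub).
Qed.

(** For a non-unit [x], an ideal maximal among those that contain [x] and avoid [1] is a maximal
    ideal, hence equal to [m]. *)
Lemma local_unit x : ~ ideal_set m x -> exists y, x * y = 1.
Proof.
move=> mx; apply: contrapT => xnu; apply: mx.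
have [|N [Nsub xN N1 Nmax]] := @maximal_submod R R^o (principal x) [set 1]
    (is_submod_ideal _).
  by move=> _ [a ->] /= ax; apply: xnu; exists a; rewrite mulrC.
pose N' := Ideal (is_ideal_submod Nsub).
have maxN : maximal_ideal N'.
  split=> [NT|J NJ]; first by apply: (N1 1) => //; change (ideal_set N' 1); rewrite NT.
  have [|/existsNP[y /not_implyP[Jy Ny]]] := pselect (ideal_set J `<=` ideal_set N').
    by move=> JN; left; apply/seteqP.
  right; apply/seteqP; split=> // a _; have [n [r [Nn /= nr]]] := Nmax y Ny.
  have [_ JD JM] := idealP J.
  rewrite -[a]mulr1 -nr; apply/JM/JD; [exact: NJ|exact: JM].
have [_ /(_ _ maxN) <-] := localR; apply: xN.
by exists 1; rewrite mul1r.
Qed.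

Lemma local_unit_sub1 x : ideal_set m (1 - x) -> exists z, x * z = 1.
Proof.
move=> m1x; apply: local_unit => mx; have [[mT _] _] := localR; apply: mT.
have [_ mD mM] := idealP m; apply/seteqP; split=> // a _.
by rewrite -[a]mulr1 -[X in a * X](subrK x); apply/mM/mD.
Qed.

Lemma gen_set_mem (s : seq R) a : a \in s -> gen_set s a.
Proof.
move=> /(nthP 0)[i ilt <-]; exists (fun k => ((k : nat) == i)%:R).
rewrite (bigD1 (Ordinal ilt)) //= eqxx mul1r big1 ?addr0 // => k.
by rewrite -val_eqE /= => /negPf ->; rewrite mul0r.
Qed.

Lemma ascending_stable (J : nat -> ideal R) :
  (forall k, J k `<=` J k.+1) -> exists k, J k.+1 `<=` J k.
Proof.
move=> JS; have Jle k l : (k <= l)%N -> J k `<=` J l.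
  elim: l => [|l IH]; first by rewrite leqn0 => /eqP ->.
  by rewrite leq_eqVlt => /orP[/eqP -> //|/IH kl x /kl/JS].
have Uideal : is_ideal [set x | exists k, ideal_set (J k) x].
  split=> [|x y [k Jx] [l Jy]|a x [k Jx]]; first by exists 0%N; case: (idealP (J 0%N)).
    exists (maxn k l); case: (idealP (J (maxn k l))) => _ JD _.
    by apply: (JD); [apply: Jle Jx; exact: leq_maxl|apply: Jle Jy; exact: leq_maxr].
  by exists k; case: (idealP (J k)) => _ _; apply.
have [s /= sU] := noethR (Ideal Uideal).
have [k sk] : exists k, forall x, x \in s -> ideal_set (J k) x.
  have : forall x, x \in s -> exists k, ideal_set (J k) x.
    by move=> x /gen_set_mem; rewrite -sU.
  elim: (s) => [|a t IH] st; first by exists 0%N.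
  have [k ka] := st a (mem_head _ _).
  have [|l lt] := IH; first by move=> x xt; apply: st; rewrite inE xt orbT.
  exists (maxn k l) => x; rewrite inE => /predU1P[-> |/lt].
    by apply: Jle ka; exact: leq_maxl.
  by apply: Jle; exact: leq_maxr.
exists k => x Jx; have : gen_set s x by rewrite -sU; exists k.+1.
move=> [c ->]; have [J0 JD JM] := idealP (J k).
by elim/big_rec: _ => // i y _ Jy; apply: (JD) => //; apply/JM/sk/mem_nth.
Qed.

Lemma ideal_expS_sub n : ideal_exp m n.+1 `<=` ideal_exp m n.
Proof.
have [E0 ED EM] := idealP (ideal_exp m n).
move=> _ [s [sm ->]]; rewrite big_seq; elim/big_rec: _ => // p y ps Ey.
by apply: (ED) => //; apply: (EM); case: (sm p ps).
Qed.

Lemma ideal_exp_sub n k : (n <= k)%N -> ideal_exp m k `<=` ideal_exp m n.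
Proof.
elim: k => [|k IH]; first by rewrite leqn0 => /eqP ->.
by rewrite leq_eqVlt => /orP[/eqP -> //|/IH kn x /ideal_expS_sub/kn].
Qed.

Lemma exp_in_ideal_exp x n : ideal_set m x -> ideal_set (ideal_exp m n) (x ^+ n).
Proof.
move=> mx; elim: n => [|n IH] //.
exists [:: (x, x ^+ n)]; split; last by rewrite big_seq1 exprS.
by move=> p; rewrite inE => /eqP ->.
Qed.

(** Instead of a pigeonhole argument on monomials, the generators of [m] are removed one at a time,
    for the property [Q c] that [m^n c] lies in [L] for some [n]. *)
Lemma nilpotent_ideal_exp_sub (L : ideal R) :
  (forall a, ideal_set m a -> exists k, ideal_set L (a ^+ k)) ->
  exists n, ideal_exp m n `<=` L.
Proof.
move=> nilL; have [s sm] := noethR m; have [L0 LD LM] := idealP L.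
pose Q c := exists n, forall y, ideal_set (ideal_exp m n) y -> ideal_set L (y * c).
have QM b c : Q c -> Q (b * c).
  by move=> [n Qc]; exists n => y /Qc Lyc; rewrite mulrCA; apply: (LM).
suff [n Q1] : Q 1 by exists n => y /Q1; rewrite mulr1.
have step : forall c, (forall a, a \in s -> Q (a * c)) -> Q c.
  move=> c Qs.
  have [n nP] : exists n, forall a, a \in s ->
      forall y, ideal_set (ideal_exp m n) y -> ideal_set L (y * (a * c)).
    move: Qs; elim: (s) => [|b t IH] Qs; first by exists 0%N.
    have [k kP] := Qs b (mem_head _ _).
    have [|l lP] := IH; first by move=> x xt; apply: Qs; rewrite inE xt orbT.
    exists (maxn k l) => a; rewrite inE => /predU1P[-> y|/lP {}lP y].
      by move=> /(ideal_exp_sub (leq_maxl k l)) /kP.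
    by move=> /(ideal_exp_sub (leq_maxr k l)) /lP.
  exists n.+1 => _ [t [tm ->]]; rewrite mulr_suml big_seq.
  elim/big_rec: _ => // p y pt Ly; apply: (LD) => //.
  have [] := tm p pt; rewrite sm => -[d ->] mp.
  rewrite !mulr_suml; elim/big_rec: _ => // i w _ Lw; apply: (LD) => //.
  rewrite -!mulrA; apply: (LM); rewrite mulrCA; apply: nP => //; exact: mem_nth.
have snil a : a \in s -> exists k, ideal_set L (a ^+ k).
  by move=> /gen_set_mem; rewrite -sm; exact: nilL.
(* [step] for [a :: t] implies [step] for [t]: [a ^+ k * c] satisfies [Q] once [a ^+ k] is in [L],
   and [step] lowers [k] to [0]. For the empty list [step] yields [Q c] outright. *)
move: (1) step snil; elim: (s) => [|a t IH] c step snil; first exact: step.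
apply: IH => [{}c Qt|b bt]; last by apply: snil; rewrite inE bt orbT.
have [k Lk] := snil a (mem_head _ _).
have : Q (a ^+ k * c) by exists 0%N => y _; rewrite mulrA mulrC mulrA; apply: (LM).
elim: k {Lk} => [|k IHk]; first by rewrite expr0 mul1r.
rewrite exprS -mulrA => Qk; apply/IHk/step => b; rewrite inE => /predU1P[-> //|/Qt].
by rewrite mulrCA; exact: QM.
Qed.

(* Take [L] maximal among the ideals containing [I] but not [z]: it satisfies
   [m z <= L], so that [z = l + r a^k] forces [a^k] into [L] as soon as the chain
   of the [(L : a^k)] stops; hence [m^n <= L] for some [n]. *)
Lemma krull_intersection (I : ideal R) z :
  (forall n, exists x y,
     [/\ ideal_set I x, ideal_set (ideal_exp m n) y & z = x + y]) ->
  ideal_set I z.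
Proof.
move=> zI; apply: contrapT => Iz.
have [|N [Nsub IN Nz Nmax]] := @maximal_submod R R^o I [set z] (is_submod_ideal _).
  by move=> x Ix /= xz; rewrite xz in Ix.
pose L := Ideal (is_ideal_submod Nsub); have [L0 LD LM] := idealP L.
(* Nakayama's argument: if [z = n + r a z], then [(1 - r a) z = n] lies in [L], and [1 - r a] is a
   unit. *)
have mz a : ideal_set m a -> ideal_set L (a * z).
  move=> ma; apply: contrapT => /Nmax[n [r [Nn /= nr]]].
  have [|w wE] := @local_unit_sub1 (1 - r * a).
    by rewrite subKr; case: (idealP m) => _ _; apply.
  apply: (Nz z) => //; have -> : z = w * n; last exact: LM.
  rewrite -[LHS]mul1r -wE mulrAC mulrC; congr (_ * _).
  by rewrite mulrBl mul1r -mulrA -[X in X - _]nr; apply: addrK.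
have [a ma|n nL] := @nilpotent_ideal_exp_sub L.
  have [k kP] : exists k, forall x,
      ideal_set L (a ^+ k.+1 * x) -> ideal_set L (a ^+ k * x).
    pose J k : set R := [set x | ideal_set L (a ^+ k * x)].
    have Jideal k : is_ideal (J k).
      split=> [|x y Jx Jy|b x Jx]; rewrite /J /=.
      - by rewrite mulr0.
      - by rewrite mulrDr; apply: (LD).
      - by rewrite mulrCA; apply: (LM).
    have [k x Jx|k kP] := @ascending_stable (fun k => Ideal (Jideal k)).
      by rewrite /= /J /= exprS -mulrA; apply: (LM).
    by exists k.
  exists k; apply: contrapT => /Nmax[n [r [Nn /= nr]]].
  apply: (Nz z) => //; rewrite -nr; apply: (LD) => //.
  rewrite [_ *: _]mulrC; apply: kP; rewrite exprS -mulrA.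
  have -> : a ^+ k * r = z - n by rewrite -nr addrC addKr mulrC.
  rewrite mulrBr -mulrN; apply: (LD); first exact: mz.
  by rewrite mulrN -mulNr; apply: (LM).
have [x [y [Ix my zxy]]] := zI n.
apply: (Nz z) => //; rewrite zxy; apply: (LD); [exact: IN|exact: nL].
Qed.

End Krull.

(** * Inverse limits of residue rings as modules *)

Section InverseLimitModule.
Variables (R : idomainType) (T : Type) (J : T -> ideal R).

Definition invlim_mod : lmodType R :=
  restr_scalars (invlim_map J : {rmorphism R -> invlim J}).

Definition invlim_coord (x : invlim_mod) (i : T) : residue (J i) :=
  invlim_val (x : invlim J) i.

Lemma invlim_coordP a (x y : invlim_mod) i :
  invlim_coord (a *: x + y) i =
  residue_map (J i) a * invlim_coord x i + invlim_coord y i.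
Proof. by []. Qed.

Lemma invlim_coordZ a (x : invlim_mod) i :
  invlim_coord (a *: x) i = residue_map (J i) a * invlim_coord x i.
Proof. by []. Qed.

Lemma invlim_ext (x y : invlim_mod) :
  (forall i, invlim_coord x i = invlim_coord y i) -> x = y.
Proof.
by move=> xy; apply: (@val_inj _ _ (invlim J)); apply: functional_extensionality_dep.
Qed.

Lemma invlim_coherent (x : invlim_mod) i j a : J i `<=` J j ->
  invlim_coord x i = residue_map (J i) a -> invlim_coord x j = residue_map (J j) a.
Proof.
have /asboolP/coherentP cx := valP (x : invlim J).
by move=> ij; exact: cx.
Qed.

Lemma residue_lift (I : ideal R) (x : residue I) : exists a, x = residue_map I a.
Proof. by exists (repr x); rewrite residue_mapK. Qed.

Lemma residue_eq0 (I : ideal R) a : residue_map I a = 0 <-> ideal_set I a.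
Proof. by rewrite -(rmorph0 (residue_map I)) residue_eqP subr0. Qed.

Lemma invlim_of_fun (a : T -> R) :
  (forall i j, J i `<=` J j -> ideal_set (J j) (a i - a j)) ->
  exists x : invlim_mod, forall i, invlim_coord x i = residue_map (J i) (a i).
Proof.
move=> ca; pose x : residue_prod J := fun i => residue_map (J i) (a i).
have Px : coherent_pred x.
  apply/asboolP/coherentP => i j ij b /residue_eqP/ij iab; apply/residue_eqP.
  have [_ JD JM] := idealP (J j).
  rewrite -[a j - b](subrKA (a i)) addrC; apply: (JD) => //.
  by rewrite -opprB -mulN1r; apply/JM/ca.
by exists (InvLim Px : invlim J).
Qed.

Lemma invlim_inj_exists : exists f : {linear R^o -> invlim_mod},
  forall a i, invlim_coord (f a) i = residue_map (J i) a.
Proof.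
have [|f fE] := @linear_exists R R^o invlim_mod (invlim_map J).
  by move=> a x y; rewrite [a *: x]/(a * x) rmorphD rmorphM.
by exists f => a i; rewrite fE.
Qed.

(** Phrased for single elements, which suffices to kill every map from the divisible module Q. *)
Definition reduced (M : lmodType R) : Prop :=
  forall x : M, (forall r : R, r != 0 -> exists y, x = r *: y) -> x = 0.

Lemma invlim_reduced :
  (forall i, exists r, r != 0 /\ ideal_set (J i) r) -> reduced invlim_mod.
Proof.
move=> Jn0 x divx; apply: invlim_ext => i; have [r [r0 Jr]] := Jn0 i.
have [y ->] := divx r r0; rewrite invlim_coordZ.
by have /residue_eq0 -> := Jr; rewrite mul0r.
Qed.

(** Supplies the map to [R/m] that a projective inverse limit would lift to R. Stating it for every
    representative [a] makes its value on the image of [1] immediate. *)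
Lemma invlim_residue_exists (m : ideal R) i : J i `<=` m ->
  exists e : {linear invlim_mod -> restr_scalars (residue_map m)},
    forall x a, invlim_coord x i = residue_map (J i) a -> e x = residue_map m a.
Proof.
move=> im; pose e0 (x : invlim_mod) : restr_scalars (residue_map m) :=
  residue_map m (repr (invlim_coord x i)).
have e0E x a : invlim_coord x i = residue_map (J i) a -> e0 x = residue_map m a.
  by move=> xa; apply/residue_eqP/im/residue_eqP; rewrite residue_mapK.
have [a x y|e eE] := @linear_exists R _ _ e0; last first.
  by exists e => x a; rewrite eE; exact: e0E.
have [b xb] := residue_lift (invlim_coord x i).
have [c yc] := residue_lift (invlim_coord y i).
rewrite (e0E _ _ xb) (e0E _ _ yc) (e0E _ (a * b + c)); last first.
  by rewrite invlim_coordP xb yc rmorphD rmorphM.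
by rewrite rmorphD rmorphM.
Qed.

End InverseLimitModule.

(** * Comparison of the fraction field with the two completions *)

Section Comparison.
Variables (R : idomainType) (m : ideal R).
Hypotheses (noethR : noetherian R) (localR : local_ring m).

Lemma reduced_fraction_hom (M : lmodType R) (f : {linear fraction_mod R -> M}) q :
  reduced M -> f q = 0.
Proof.
move=> redM; apply: redM => r r0; have [y <-] := fraction_divisible q r0.
by exists (f y); rewrite linearZ.
Qed.

Lemma fraction_one_neq0 : fraction_one R <> 0.
Proof. by apply/eqP; exact: (@oner_neq0 {fraction R}). Qed.

(* If [S] is projective, lifting the residue map to [S -> R] splits off [R], so
   that [C] and [Q] embed in [S], which is reduced; hence [n] is positive. *)
Lemma pd_le_fraction n (S C : lmodType R) (f : {linear R^o -> S})
    (e : {linear S -> restr_scalars (residue_map m)}) (q : {linear S -> C})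
    (j : {linear fraction_mod R -> C}) :
  short_exact f q -> reduced S -> e (f 1) = residue_map m 1 -> injective j ->
  pd_le n S -> pd_le n (fraction_mod R).
Proof.
move=> fqex redS ef1 injj; case: n => [projS|n pdS]; last first.
  have [p pK] := divisible_split injj (@fraction_torsion_free R) (@fraction_divisible R).
  apply: (@pd_le_retract _ _ _ C); first by exists j, p.
  exact: pd_le_coker fqex pdS.
exfalso; have [injf fq qs] := fqex.
have [|g gE] := @linear_exists R R^o (restr_scalars (residue_map m)) (residue_map m).
  by move=> a x y; rewrite rmorphD rmorphM.
have gs : range g = setT.
  by apply: surjI => y; have [a ->] := residue_lift y; exists a; rewrite gE.
have [h hE] := projS _ _ g e gs.
(* The lift satisfies [h (f 1) = 1] modulo [m], so this value is a unit; its inverse [v] turns [h]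
   into a retraction of [f]. *)
have [|v hv] := @local_unit_sub1 _ _ localR (h (f 1)).
  by apply/residue_eqP; rewrite -ef1 -hE gE.
have [|s sE] := @linear_exists R S S (fun x => x - f (v *: h x)).
  move=> a x y; have -> : f (v *: h (a *: x + y)) = a *: f (v *: h x) + f (v *: h y).
    by rewrite linearP scalerDr [v *: (a *: _)]scalerA mulrC -scalerA linearP.
  by rewrite opprD [LHS]addrACA scalerBr.
have [x|t tE] := @factor_quotient _ _ _ _ q s qs.
  move=> /(exact_ker fq)[a <-]; rewrite sE; apply/eqP; rewrite subr_eq0; apply/eqP.
  have fa : f a = a *: f 1 by rewrite -linearZ; congr (f _); exact/esym/mulr1.
  congr (f _); rewrite fa linearZ; change (a = v * (a * h (f 1))).
  by rewrite mulrCA [v * _]mulrC hv mulr1.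
apply: fraction_one_neq0; apply: injj; rewrite linear0.
have [y jy] := surjP qs (j (fraction_one R)).
have : t (j (fraction_one R)) = 0 by exact: (reduced_fraction_hom (t \o j)).
rewrite -jy tE sE => /eqP; rewrite subr_eq0 => /eqP ->.
exact: (exact_comp0 _ fq).
Qed.

Lemma fraction_embedding (C : lmodType R) (c : C) :
  torsion_free C -> divisible C -> c <> 0 ->
  exists j : {linear fraction_mod R -> C}, injective j.
Proof.
move=> tfC divC c0; have [j jE] := fraction_lift c tfC divC; exists j.
by apply: fraction_mod_injective => //; rewrite jE.
Qed.

Local Notation nonzero := {r : R | r != 0}.
Local Notation Rt := (invlim_mod (fun r : nonzero => principal (sval r))).
Local Notation Rh := (invlim_mod (ideal_exp m)).

Definition nz (r : R) (r0 : r != 0) : nonzero := exist _ r r0.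

Lemma principal_mulr (r s : R) : principal (r * s) `<=` principal s.
Proof. by move=> _ [a ->]; exists (a * r); rewrite mulrA. Qed.

Lemma principal_mull (r s : R) : principal (r * s) `<=` principal r.
Proof. by rewrite mulrC; exact: principal_mulr. Qed.

Lemma principal_mem (r : R) : ideal_set (principal r) r.
Proof. by exists 1; rewrite mul1r. Qed.

(** The coordinate at [s] is read off the one at [r * s], where [r a] in [rsR] gives [a] in [sR]. *)
Lemma R_completion_torsion_free : torsion_free Rt.
Proof.
move=> r x r0 rx; apply: invlim_ext => -[s s0].
have rs0 : r * s != 0 by rewrite mulf_neq0.
have [a xa] := residue_lift (invlim_coord x (nz rs0)).
rewrite (@invlim_coherent _ _ _ x (nz rs0) _ a) //; last exact: principal_mulr.
have : invlim_coord (r *: x) (nz rs0) = 0 by rewrite rx.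
rewrite invlim_coordZ xa -rmorphM => /residue_eq0[c rac].
apply/residue_eq0; exists c; apply: (mulfI r0).
by rewrite rac mulrCA.
Qed.

(* A coherent family vanishing in [R/rR] is [r] times the family obtained by
   dividing by [r] its components in the [R/rsR]. *)
Lemma R_completion_div r (r0 : r != 0) (x : Rt) :
  invlim_coord x (nz r0) = 0 -> exists y : Rt, r *: y = x.
Proof.
move=> xr; have rs0 (s : nonzero) : r * sval s != 0 by rewrite mulf_neq0 // (svalP s).
have /choice[d dE] : forall s : nonzero, exists d,
    invlim_coord x (nz (rs0 s)) = residue_map _ (r * d).
  move=> s; have [c xc] := residue_lift (invlim_coord x (nz (rs0 s))).
  have := @invlim_coherent _ _ _ x (nz (rs0 s)) (nz r0) c.
  move=> /(_ (@principal_mull _ _) xc); rewrite xr => /esym/residue_eq0[d cd].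
  by exists d; rewrite xc cd; congr (residue_map _ _); exact: mulrC.
have [s t st|y yE] := @invlim_of_fun _ _ (fun r : nonzero => principal (sval r)) d.
  have sub : principal (r * sval s) `<=` principal (r * sval t).
    have [b sE] := st _ (principal_mem (sval s)).
    by move=> _ [a ->]; exists (a * b); rewrite sE [r * _]mulrCA !mulrA.
  have := @invlim_coherent _ _ _ x (nz (rs0 s)) (nz (rs0 t)) _ sub (dE s).
  rewrite dE => /esym/residue_eqP[c]; rewrite -mulrBr => rE.
  by exists c; apply: (mulfI r0); rewrite rE mulrCA.
exists y; apply: invlim_ext => s; rewrite invlim_coordZ yE -rmorphM.
by rewrite (@invlim_coherent _ _ _ x (nz (rs0 s)) s _ _ (dE s)) //; exact: principal_mulr.
Qed.

Section RCompletionQuotient.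
Variables (f : {linear R^o -> Rt}) (C : lmodType R) (q : {linear Rt -> C}).
Hypotheses (fE : forall a i, invlim_coord (f a) i = residue_map _ a)
  (fq : short_exact f q).

(** If [r x = a] with [a] in R, the coordinate in [R/rR] shows [a = r b], and then [x = b] because
    the completion is torsion free. *)
Lemma R_completion_quotient_torsion_free : torsion_free C.
Proof.
have [injf fker qs] := fq.
move=> r c r0; have [x <-] := surjP qs c; rewrite -linearZ => /(exact_ker fker)[a fa].
have [b ab] : ideal_set (principal r) a.
  apply/residue_eq0; rewrite -(fE a (nz r0)) fa invlim_coordZ.
  by have /residue_eq0 -> := principal_mem r; rewrite mul0r.
have -> : x = f b; last exact: (exact_comp0 _ fker).
apply: (torsion_freeI R_completion_torsion_free r0).
by rewrite -[LHS]fa -[RHS]linearZ ab mulrC.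
Qed.

(** Density of R: subtracting from [x] a representative of its coordinate in [R/rR] leaves a
    multiple of [r]. *)
Lemma R_completion_quotient_divisible : divisible C.
Proof.
have [injf fker qs] := fq.
move=> r c r0; have [x <-] := surjP qs c.
have [a xa] := residue_lift (invlim_coord x (nz r0)).
have [|y yE] := @R_completion_div r r0 (x - f a).
  rewrite -[x]scale1r -scaleN1r addrC invlim_coordP fE invlim_coordZ xa.
  by rewrite -!rmorphM -rmorphD mulN1r mul1r addNr rmorph0.
exists (q y); rewrite -linearZ yE raddfB /=.
by rewrite (exact_comp0 _ fker) subr0.
Qed.

End RCompletionQuotient.

Hypothesis m0 : exists r, r != 0 /\ ideal_set m r.

Lemma ideal_exp_neq0 n : exists r, r != 0 /\ ideal_set (ideal_exp m n) r.
Proof.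
have [r [r0 mr]] := m0; exists (r ^+ n); rewrite expf_neq0 //.
by split=> //; exact: exp_in_ideal_exp.
Qed.

(** A nonzero [s] in [m^n] gives a map from [R/sR] to [R/m^n]. Allowing every such [s] in the
    conclusion, not a chosen one, makes compatibility with the maps from R immediate. *)
Lemma R_to_adic_completion_exists : exists g : {linear Rt -> Rh},
  forall x s n a, ideal_set (ideal_exp m n) (sval s) ->
    invlim_coord x s = residue_map _ a -> invlim_coord (g x) n = residue_map _ a.
Proof.
have /choice[r rP] : forall n, exists r : nonzero, ideal_set (ideal_exp m n) (sval r).
  by move=> n; have [r [r0 mr]] := ideal_exp_neq0 n; exists (nz r0).
have principal_sub (I : ideal R) a : ideal_set I a -> principal a `<=` I.
  by move=> Ia _ [b ->]; case: (idealP I) => _ _; apply.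
(* Two indices [s] and [t] are compared through their common multiple [s * t]. *)
have xrP (x : Rt) (s t : nonzero) n a b : ideal_set (ideal_exp m n) (sval s) ->
    ideal_set (ideal_exp m n) (sval t) ->
    invlim_coord x s = residue_map _ a -> invlim_coord x t = residue_map _ b ->
    ideal_set (ideal_exp m n) (a - b).
  move=> ms mt xs xt.
  have st0 : sval s * sval t != 0 by rewrite mulf_neq0 // (svalP s, svalP t).
  have [c xc] := residue_lift (invlim_coord x (nz st0)).
  have := @invlim_coherent _ _ _ x (nz st0) s c (@principal_mull _ _) xc.
  rewrite xs => /residue_eqP/(principal_sub _ _ ms) ac.
  have := @invlim_coherent _ _ _ x (nz st0) t c (@principal_mulr _ _) xc.
  rewrite xt => /residue_eqP/(principal_sub _ _ mt) bc.
  have [_ mD mM] := idealP (ideal_exp m n).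
  rewrite -(subrKA c); apply: (mD) => //.
  by rewrite -opprB -mulN1r; apply: (mM).
have /choice[g0 g0E] : forall x : Rt, exists y : Rh,
    forall n, invlim_coord y n = residue_map _ (repr (invlim_coord x (r n))).
  move=> x; apply: invlim_of_fun => i j ij.
  apply: (xrP x (r i) (r j)); rewrite ?residue_mapK //; exact: ij.
have g0P x s n a : ideal_set (ideal_exp m n) (sval s) ->
    invlim_coord x s = residue_map _ a -> invlim_coord (g0 x) n = residue_map _ a.
  move=> ms xs; rewrite g0E; apply/residue_eqP.
  by apply: (xrP x (r n) s); rewrite ?residue_mapK.
have [a x y|g gE] := @linear_exists R Rt Rh g0; last first.
  by exists g => x s n a; rewrite gE; exact: g0P.
apply: invlim_ext => n; rewrite invlim_coordP.
have [b xb] := residue_lift (invlim_coord x (r n)).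
have [c yc] := residue_lift (invlim_coord y (r n)).
rewrite (g0P x _ n b (rP n) xb) (g0P y _ n c (rP n) yc) -rmorphM -rmorphD.
apply: (g0P _ (r n)) => //.
by rewrite invlim_coordP xb yc -rmorphM -rmorphD.
Qed.

(** Let [c] represent the coordinate of [x] at [r]. For nonzero [s] in [m^n], a representative [e]
    at [r * s] agrees with [c] modulo [r] and lies in [m^n] since [g x = 0]; so [c] is in [rR + m^n]
    for all [n]. *)
Lemma R_to_adic_completion_injective (g : {linear Rt -> Rh}) :
  (forall x s n a, ideal_set (ideal_exp m n) (sval s) ->
    invlim_coord x s = residue_map _ a -> invlim_coord (g x) n = residue_map _ a) ->
  injective g.
Proof.
move=> gE; apply: raddf_inj => x gx; apply: invlim_ext => -[r r0].
have [c xc] := residue_lift (invlim_coord x (nz r0)).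
rewrite [LHS]xc; apply/residue_eq0/(krull_intersection noethR localR) => n.
have [s [s0 ms]] := ideal_exp_neq0 n.
have rs0 : r * s != 0 by rewrite mulf_neq0.
have [e xe] := residue_lift (invlim_coord x (nz rs0)).
exists (c - e), e; split; last by rewrite subrK.
  apply/residue_eqP; rewrite -[LHS]xc.
  by apply: (@invlim_coherent _ _ _ x (nz rs0) (nz r0) e _ xe); exact: principal_mull.
apply/residue_eq0; rewrite -(gE x (nz rs0)) //; first by rewrite gx.
by case: (idealP (ideal_exp m n)) => _ _; apply.
Qed.

End Comparison.

Theorem proposition7p5 (R : idomainType) (m : ideal R)
    (noethR : noetherian R) (localR : local_ring m)
    (properR : injective (to_R_completion R) /\
               range (to_R_completion R) <> setT) :
  proj_dim (restr_scalars (@tofrac R : {rmorphism R -> {fraction R}}))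
    = proj_dim (restr_scalars (to_R_completion R))
  /\ (proj_dim (restr_scalars (to_R_completion R))
        <= proj_dim (restr_scalars (to_adic_completion m)))%E.
Proof.
have [injR RnT] := properR.
(* Otherwise R is a field, every [R/rR] vanishes, and [1] goes to [0] in the completion. *)
have m0 : exists r, r != 0 /\ ideal_set m r.
  apply: contrapT => nm; suff : (1 : R) = 0 by apply/eqP; exact: oner_neq0.
  apply: injR; apply: (@invlim_ext _ _ (fun r : {r : R | r != 0} => principal (sval r))).
  move=> [r r0]; apply/residue_eqP; rewrite subr0.
  have [|s rs] := @local_unit _ _ localR r; first by move=> mr; apply: nm; exists r.
  by exists s; rewrite mulrC rs.
have [r [r0 mr]] := m0.
pose J := fun r : {r : R | r != 0} => principal (sval r).
change ((proj_dim (fraction_mod R) = proj_dim (invlim_mod J)) /\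
  (proj_dim (invlim_mod J) <= proj_dim (invlim_mod (ideal_exp m)))%E).
have [f fE] := invlim_inj_exists J.
have injf : injective f.
  move=> a b fab; apply: injR; apply: (@invlim_ext _ _ J) => i.
  by transitivity (invlim_coord (f a) i); [rewrite fE|rewrite fab fE].
have [C [q [qs qf]]] := quotient_exists (is_submod_range f).
have fq : short_exact f q by split.
have tfC := R_completion_quotient_torsion_free fE fq.
have divC := R_completion_quotient_divisible fE fq.
have [x qx] : exists x, q x <> 0.
  apply: contrapT => q0; apply: RnT; apply/seteqP; split=> // x _.
  have [a fa] : exists a, f a = x.
    by apply: (exact_ker (esym qf)); apply: contrapT => qx; apply: q0; exists x.
  exists a => //; apply: (@invlim_ext _ _ J) => i; rewrite -fa fE //.
have [j injj] := fraction_embedding tfC divC qx.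
have Qt n : pd_le n (fraction_mod R) -> pd_le n (invlim_mod J).
  by move=> pdQ; apply: (pd_le_extension fq); apply: pd_le_divisible.
have tQ n : pd_le n (invlim_mod J) -> pd_le n (fraction_mod R).
  have [|e eE] := @invlim_residue_exists _ _ J m (nz r0).
    by move=> _ [a ->]; case: (idealP m) => _ _; apply.
  apply: (pd_le_fraction localR fq _ (eE _ _ (fE 1 _)) injj).
  apply: invlim_reduced => -[s s0]; exists s; split=> //; exact: principal_mem.
split; first by apply/le_anti/andP; split; apply: proj_dim_le.
apply: proj_dim_le => n pdh; apply: Qt; move: pdh.
have [g gE] := R_to_adic_completion_exists m0.
have injg := R_to_adic_completion_injective noethR localR m0 gE.
have [fh fhE] := invlim_inj_exists (ideal_exp m).
have gf a : g (f a) = fh a.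
  apply: invlim_ext => n'; have [s [s0 ms]] := ideal_exp_neq0 m0 n'.
  by rewrite fhE; apply: (gE _ (nz s0)) => //; rewrite fE.
have injfh : injective fh by move=> a b; rewrite -!gf => /injg/injf.
have [Ch [qh [qhs qhf]]] := quotient_exists (is_submod_range fh).
have fqh : short_exact fh qh by split.
have [y|t tE] := @factor_quotient _ _ _ _ q (qh \o g) qs.
  move=> /(exact_ker (esym qf))[a <-] /=.
  by rewrite gf (exact_comp0 _ (esym qhf)).
(* [g] matches the two copies of R and is injective, so [g y] in R forces [y] in R. *)
have injt : injective t.
  apply: raddf_inj => c; have [y <-] := surjP qs c => ty.
  have /(exact_ker (esym qhf))[a] : qh (g y) = 0 by exact: etrans (esym (tE y)) ty.
  rewrite -gf => /injg <-.
  exact: (exact_comp0 _ (esym qf)).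
(* The index is [1] because [ideal_exp m 0] is the unit ideal, which is not contained in [m]. *)
have [|e eE] := @invlim_residue_exists _ _ (ideal_exp m) m 1%N.
  move=> _ [s [sm ->]]; have [M0 MD MM] := idealP m.
  rewrite big_seq; elim/big_rec: _ => // p z ps mz; apply: (MD) => //.
  by rewrite mulrC; apply: MM; case: (sm p ps).
apply: (pd_le_fraction (j := t \o j) localR fqh _ (eE _ _ (fhE 1 _))).
  by apply: invlim_reduced => n'; exact: ideal_exp_neq0.
exact: inj_comp.
Qed.
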